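(* Let $I\subseteq\mathbb{R}$ be a nondegenerate (possibly infinite) interval containing $0$, let $r:I\to(0,\infty)$ be continuous, and let $W(\theta)=r(\theta)(\sin\theta,-\cos\theta)$, $\theta\in I$, be the corresponding wheel with center $(0,0)$. Suppose that the wheel $W$ rolls smoothly along a road without slipping, with rotation-angle function $\rho$ and horizontal-displacement function $\tau$ (in the sense defined in the context). Then for every $\theta\in I$ the contact point of $W(\theta)$ as the wheel rolls, namely $\sigma_{W(\theta)}(\rho(\theta))$, is $$\left(\int_0^\theta r(t)\,dt,\ -r(\theta)\right).$$
   Context: For $\phi\in\mathbb{R}$ let $M(\phi)=\begin{pmatrix}\cos\phi&\sin\phi\\-\sin\phi&\cos\phi\end{pmatrix}$ be the matrix of clockwise rotation by $\phi$. The wheel is not required to be a closed curve, and $r$ is not required to be differentiable. The wheel $W$ *rolls smoothly along a road without slipping* with functions $\rho,\tau$ if the following hold. (1) $\rho:I\to J$ is a continuous function into a nondegenerate interval $J\subseteq\mathbb{R}$ with $\rho(0)=0$. Here $\rho(\theta)$ is the clockwise rotation angle required for the point $W(\theta)$ to come into contact with the road. (2) $\tau:J\to\mathbb{R}$ is differentiable (one-sided at endpoints). Here $\tau(\phi)$ is the horizontal displacement of the wheel when it has rotated by $\phi$. The initial contact point (that of $W(0)$) is $(0,-r(0))$, so $\tau(0)=0$. (3) For a point $P$ of the wheel, write $\sigma_P(\phi)=M(\phi)P+(\tau(\phi),0)$ for its position after rotation by $\phi$. The *no-slipping condition* holds: for every $\theta\in I$, with $P=W(\theta)$ held fixed, the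 derivative with respect to $\phi$ satisfies $\sigma_P'(\rho(\theta))=(0,0)$. The *contact point* of $W(\theta)$ is the point $\sigma_{W(\theta)}(\rho(\theta))$; the road is the curve formed by the contact points. *)

(* Defs.v *)
From Stdlib Require Import Reals.
From Coquelicot Require Import Coquelicot.
Open Scope R_scope.

Definition nondegenerate_interval (D : R -> Prop) : Prop :=
  (forall x y z, D x -> D y -> x <= z <= y -> D z) /\
  (exists x y, D x /\ D y /\ x < y).

(** [l] is the derivative at [x] of [f] restricted to [D]: two-sided at interior
    points of [D], one-sided at endpoints.  Coquelicot's [is_derive f x l] is the
    same formula with [locally x] in place of [within D (locally x)]. *)
Definition is_derive_within {V : NormedModule R_AbsRing}
  (D : R -> Prop) (f : R -> V) (x : R) (l : V) : Prop :=
  filterdiff f (within D (locally x)) (fun h : R => scal h l).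

Definition ex_derive_within {V : NormedModule R_AbsRing}
  (D : R -> Prop) (f : R -> V) (x : R) : Prop :=
  exists l : V, is_derive_within D f x l.

(** Product of the clockwise rotation matrix
    [[cos phi, sin phi], [- sin phi, cos phi]] with the column vector [P]. *)
Definition rotate (phi : R) (P : R * R) : R * R :=
  (cos phi * fst P + sin phi * snd P, - sin phi * fst P + cos phi * snd P).

Definition wheel (r : R -> R) (theta : R) : R * R :=
  (r theta * sin theta, r theta * - cos theta).

Definition position (tau : R -> R) (P : R * R) (phi : R) : R * R :=
  (fst (rotate phi P) + tau phi, snd (rotate phi P) + 0).

(** [r] and [rho] are only meaningful on [I], and [tau] on [J]; in the no-slipping
    condition the point [P = wheel r theta] is held fixed while the angle varies
    in [J]. *)
Record rolls_smoothly (I : R -> Prop) (r : R -> R)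
  (J : R -> Prop) (rho tau : R -> R) : Prop := {
  rolls_J : nondegenerate_interval J;
  rolls_rho_J : forall theta, I theta -> J (rho theta);
  rolls_rho_continuous : continuous_on I rho;
  rolls_rho_0 : rho 0 = 0;
  rolls_tau_derivable : forall phi, J phi -> ex_derive_within J tau phi;
  rolls_tau_0 : tau 0 = 0;
  rolls_no_slip : forall theta, I theta ->
    is_derive_within J (position tau (wheel r theta)) (rho theta) (0, 0)
}.

Definition contact_point (r rho tau : R -> R) (theta : R) : R * R :=
  position tau (wheel r theta) (rho theta).

(* Main.v *)
Require Import Defs.
From Stdlib Require Import Reals Lra.
From Coquelicot Require Import Coquelicot.
Open Scope R_scope.

(** Write the no-slipping condition at [phi = rho theta] in coordinates.  The
    vertical one says [sin (theta - rho theta) = 0]; since [theta - rho theta] is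
    continuous and vanishes at [0], it vanishes identically.  So [rho] is the
    identity on [I], and the horizontal component becomes
    [tau' theta = r theta], which integrates to the claim. *)

(** * Derivatives relative to a subset of the line *)

Lemma within_locally_le {T : UniformSpace} (D E : T -> Prop) (x : T) :
  (forall y, E y -> D y) ->
  filter_le (within E (locally x)) (within D (locally x)).
Proof.
  intros HED P HP; unfold within in *.
  revert HP; apply filter_imp; auto.
Qed.

(** [filterdiff] demands the little-o estimate at every limit of the filter. When [D x] holds, the
    only such limit is [x] itself, so a single estimate at [x] suffices. *)
Lemma is_derive_within_iff {V : NormedModule R_AbsRing} (D : R -> Prop)
  (f : R -> V) (x : R) (l : V) :
  D x ->
  (is_derive_within D f x l <->
   is_domin (within D (locally x)) (fun y : R => minus y x)
     (fun y => minus (minus (f y) (f x)) (scal (minus y x) l))).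
Proof.
  intros Dx; split.
  - intros [_ H]; apply (H x).
    intros P HP; unfold within; revert HP; apply filter_imp; auto.
  - intros H; split; [exact (is_linear_scal_l (K := R_AbsRing) l)|].
    intros z Hz.
    (* Limits are unique only along a proper filter; here [x] itself witnesses that each member is
       inhabited. *)
    assert (PF : ProperFilter (within D (locally x))).
    { constructor; [|apply within_filter, locally_filter].
      intros P HP; exists x; exact (locally_singleton _ _ HP Dx). }
    assert (E : x = z); [|subst z; exact H].
    apply (is_filter_lim_unique (F := within D (locally x))); [|exact Hz].
    intros P HP; unfold within; revert HP; apply filter_imp; auto.
Qed.

(** Serves to carry the derivative of [tau] from [J] over to [I]. *)
Lemma is_derive_within_subset {V : NormedModule R_AbsRing} (D E : R -> Prop)
  (f : R -> V) (x : R) (l : V) :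
  (forall y, E y -> D y) -> E x ->
  is_derive_within D f x l -> is_derive_within E f x l.
Proof.
  intros HED Ex H.
  apply is_derive_within_iff in H; auto.
  apply is_derive_within_iff; [exact Ex|].
  intros eps; exact (within_locally_le D E x HED _ (H eps)).
Qed.

Lemma is_derive_is_derive_within {V : NormedModule R_AbsRing} (D : R -> Prop)
  (f : R -> V) (x : R) (l : V) :
  D x -> is_derive f x l -> is_derive_within D f x l.
Proof.
  intros Dx [_ H]; apply is_derive_within_iff; [exact Dx|].
  intros eps.
  generalize (H x (fun P HP => HP) eps); unfold within.
  apply filter_imp; auto.
Qed.

Lemma is_derive_within_is_derive {V : NormedModule R_AbsRing} (D : R -> Prop)
  (f : R -> V) (x : R) (l : V) :
  locally x D -> is_derive_within D f x l -> is_derive f x l.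
Proof.
  intros HD H.
  apply is_derive_within_iff in H; [|exact (locally_singleton _ _ HD)].
  split; [exact (is_linear_scal_l (K := R_AbsRing) l)|].
  intros z Hz.
  apply (is_filter_lim_locally_unique (V := R_NormedModule)) in Hz; subst z.
  intros eps; generalize (filter_and _ _ HD (H eps)); unfold within.
  apply filter_imp; tauto.
Qed.

Lemma is_derive_within_minus {V : NormedModule R_AbsRing} (D : R -> Prop)
  (f g : R -> V) (x : R) (l m : V) :
  is_derive_within D f x l -> is_derive_within D g x m ->
  is_derive_within D (fun y => minus (f y) (g y)) x (minus l m).
Proof.
  intros Hf Hg; unfold is_derive_within in *.
  apply filterdiff_ext_lin
    with (fun h : R => minus (scal h l) (scal h m)).
  - apply (filterdiff_minus_fct f g); assumption.
  - intros h; unfold minus.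
    rewrite (scal_distr_l h l), <- (scal_opp_r h m); reflexivity.
Qed.

Lemma is_derive_within_fst {U V : NormedModule R_AbsRing} (D : R -> Prop)
  (f : R -> U * V) (x : R) (l : U * V) :
  is_derive_within D f x l ->
  is_derive_within D (fun y => fst (f y)) x (fst l).
Proof.
  intros Hf.
  exact (filterdiff_comp f fst _ fst Hf (filterdiff_linear fst is_linear_fst)).
Qed.

Lemma is_derive_within_snd {U V : NormedModule R_AbsRing} (D : R -> Prop)
  (f : R -> U * V) (x : R) (l : U * V) :
  is_derive_within D f x l ->
  is_derive_within D (fun y => snd (f y)) x (snd l).
Proof.
  intros Hf.
  exact (filterdiff_comp f snd _ snd Hf (filterdiff_linear snd is_linear_snd)).
Qed.

(** Nondegeneracy provides some [z] of [D] other than [x]. Moving from [x] towards [z] by at most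
    half the radius of the neighbourhood stays in [D] by convexity. *)
Lemma nondegenerate_interval_accumulation (D : R -> Prop) (x : R)
  (P : R -> Prop) :
  nondegenerate_interval D -> D x -> within D (locally x) P ->
  exists y, P y /\ y <> x.
Proof.
  intros [HD [a [b [Da [Db Hab]]]]] Dx [d Hd].
  assert (Hz : exists z, D z /\ z <> x).
  { destruct (Req_dec a x); [exists b|exists a]; split; auto; lra. }
  destruct Hz as [z [Dz Hz]].
  assert (Hd0 := cond_pos d).
  destruct (Rlt_or_le x z) as [Hxz|Hxz].
  - assert (H1 := Rmin_l z (x + d / 2)); assert (H2 := Rmin_r z (x + d / 2)).
    assert (H3 : x < Rmin z (x + d / 2)) by (apply Rmin_glb_lt; lra).
    exists (Rmin z (x + d / 2)); split; [|lra].
    apply Hd; [|apply (HD x z); auto; lra].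
    apply Rabs_def1; unfold minus, plus, opp; simpl; lra.
  - assert (H1 := Rmax_l z (x - d / 2)); assert (H2 := Rmax_r z (x - d / 2)).
    assert (H3 : Rmax z (x - d / 2) < x) by (apply Rmax_lub_lt; lra).
    exists (Rmax z (x - d / 2)); split; [|lra].
    apply Hd; [|apply (HD z x); auto; lra].
    apply Rabs_def1; unfold minus, plus, opp; simpl; lra.
Qed.

(** The zero function [f - f] has derivative [l - m]. At some [y <> x] the estimate then reads
    [|y - x| * |l - m| <= eps * |y - x|], and [y - x] cancels. *)
Lemma is_derive_within_unique (D : R -> Prop) (f : R -> R) (x l m : R) :
  nondegenerate_interval D -> D x ->
  is_derive_within D f x l -> is_derive_within D f x m -> l = m.
Proof.
  intros HD Dx Hl Hm.
  assert (H := is_derive_within_minus D f f x l m Hl Hm).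
  apply is_derive_within_iff in H; [|exact Dx].
  apply Rminus_diag_uniq, Rabs_eq_0.
  apply Rle_antisym; [|apply Rabs_pos].
  apply le_epsilon; intros eps Heps.
  destruct (nondegenerate_interval_accumulation D x _ HD Dx (H (mkposreal eps Heps)))
    as [y [Hy Hyx]].
  revert Hy; unfold norm, minus, plus, opp, scal; simpl; unfold abs, mult; simpl.
  replace (f y + - f y + - (f x + - f x) + - ((y + - x) * (l + - m)))
    with (- ((y - x) * (l - m))) by ring.
  rewrite Rabs_Ropp, Rabs_mult; intros Hy.
  assert (0 < Rabs (y - x)) by (apply Rabs_pos_lt; lra).
  apply Rmult_le_reg_l with (Rabs (y - x)); [assumption|].
  unfold Rminus in *; lra.
Qed.

Lemma is_derive_within_continuous (D : R -> Prop) (f : R -> R) (x l : R) :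
  D x -> is_derive_within D f x l ->
  filterlim f (within D (locally x)) (locally (f x)).
Proof.
  intros Dx H; apply is_derive_within_iff in H; [|exact Dx].
  apply filterlim_locally; intros eps.
  (* Tolerance 1 in the little-o estimate gives [|f y - f x| <= (1 + |l|) * |y - x|] near [x],
     whence the radius [eps / (1 + Rabs l)]. *)
  specialize (H (mkposreal 1 Rlt_0_1)).
  assert (Hk : 0 < 1 + Rabs l) by (generalize (Rabs_pos l); lra).
  assert (Hd : 0 < eps / (1 + Rabs l))
    by (apply Rdiv_lt_0_compat; [apply cond_pos|exact Hk]).
  assert (Hb : locally x (fun y => Rabs (y - x) < eps / (1 + Rabs l)))
    by (exists (mkposreal _ Hd); intros y Hy; exact Hy).
  generalize (filter_and (F := locally x) _ _ H Hb); unfold within.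
  apply filter_imp; intros y [H1 H2] Dy; specialize (H1 Dy).
  revert H1; unfold norm, minus, plus, opp, scal; simpl; unfold abs, mult; simpl.
  intros H1; change (Rabs (f y - f x) < eps).
  replace (f y - f x) with ((f y + - f x + - ((y + - x) * l)) + (y - x) * l) by ring.
  eapply Rle_lt_trans; [apply Rabs_triang|].
  rewrite Rabs_mult.
  apply Rmult_lt_compat_r with (r := 1 + Rabs l) in H2; [|exact Hk].
  replace (eps / (1 + Rabs l) * (1 + Rabs l)) with (pos eps) in H2
    by (field; lra).
  unfold Rminus in *; lra.
Qed.

(** * Clamping to a segment, with its use for intermediate values and integration *)

(** For [a <= b], the nearest-point retraction of the line onto the segment. *)
Definition clamp (a b x : R) : R := Rmax a (Rmin b x).

Lemma clamp_between (a b x : R) : a <= b -> a <= clamp a b x <= b.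
Proof.
  intros Hab; unfold clamp; split; [apply Rmax_l|].
  apply Rmax_lub; [exact Hab|apply Rmin_l].
Qed.

Lemma clamp_id (a b x : R) : a <= x <= b -> clamp a b x = x.
Proof.
  intros H; unfold clamp; rewrite Rmin_right, Rmax_right; lra.
Qed.

Lemma clamp_lipschitz (a b x y : R) :
  Rabs (clamp a b y - clamp a b x) <= Rabs (y - x).
Proof.
  unfold clamp, Rmax, Rmin, Rabs.
  repeat (destruct Rle_dec || destruct Rcase_abs); lra.
Qed.

(** Since [clamp] is 1-Lipschitz with values in [D], a radius that works for [f] relative to [D] at
    the clamped point also works for the composite. *)
Lemma continuous_clamp (D : R -> Prop) (f : R -> R) (a b : R) :
  a <= b -> (forall x, a <= x <= b -> D x) -> continuous_on D f ->
  forall x, continuous (fun y => f (clamp a b y)) x.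
Proof.
  intros Hab HD Hf x.
  apply filterlim_comp with (within D (locally (clamp a b x))).
  - intros P [d Hd]; exists d; intros y Hy.
    apply Hd; [|apply HD, clamp_between, Hab].
    exact (Rle_lt_trans _ _ _ (clamp_lipschitz a b x y) Hy).
  - apply Hf, HD, clamp_between, Hab.
Qed.

Lemma interval_between (D : R -> Prop) (x y : R) :
  nondegenerate_interval D -> D x -> D y ->
  forall z, Rmin x y <= z <= Rmax x y -> D z.
Proof.
  intros [HD _] Dx Dy z; unfold Rmin, Rmax.
  destruct Rle_dec; intros Hz; [apply (HD x y)|apply (HD y x)]; auto.
Qed.

Lemma Rmin_le_Rmax (x y : R) : Rmin x y <= Rmax x y.
Proof. exact (Rle_trans _ _ _ (Rmin_l x y) (Rmax_l x y)). Qed.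

Lemma Rmin_max_l (x y : R) : Rmin x y <= x <= Rmax x y.
Proof. split; [apply Rmin_l|apply Rmax_l]. Qed.

Lemma Rmin_max_r (x y : R) : Rmin x y <= y <= Rmax x y.
Proof. split; [apply Rmin_r|apply Rmax_r]. Qed.

(** [IVT_gen] asks for continuity on the whole line, so it is applied to the clamped function, which
    agrees with [f] between [a] and [b]. *)
Lemma IVT_interval (D : R -> Prop) (f : R -> R) (a b y : R) :
  nondegenerate_interval D -> continuous_on D f -> D a -> D b ->
  Rmin (f a) (f b) <= y <= Rmax (f a) (f b) ->
  exists x, D x /\ f x = y.
Proof.
  intros HD Hf Da Db Hy.
  pose (g := fun x => f (clamp (Rmin a b) (Rmax a b) x)).
  destruct (IVT_gen g a b y) as [x [Hx Hgx]].
  - intros x; apply continuity_pt_filterlim.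
    apply (continuous_clamp D); auto using Rmin_le_Rmax.
    apply interval_between; assumption.
  - unfold g; rewrite !clamp_id; auto using Rmin_max_l, Rmin_max_r.
  - exists x; split; [exact (interval_between D a b HD Da Db x Hx)|].
    unfold g in Hgx; rewrite clamp_id in Hgx; assumption.
Qed.

(** A nonzero value of [f] would force, by intermediate values from [f a = 0], a nonzero value in
    [[-1, 1]]. As [1 < PI / 2], the sine does not vanish there. *)
Lemma continuous_on_sin_eq_0 (D : R -> Prop) (f : R -> R) (a : R) :
  nondegenerate_interval D -> continuous_on D f -> D a -> f a = 0 ->
  (forall x, D x -> sin (f x) = 0) ->
  forall x, D x -> f x = 0.
Proof.
  intros HD Hf Da Hfa Hsin x Dx.
  assert (HPI := PI2_1).
  destruct (Rtotal_order (f x) 0) as [H|[H|H]]; [exfalso|exact H|exfalso].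
  (* Truncating [f x] at -1 yields a value that lies between [f x] and 0 and still above [-PI]. *)
  - destruct (IVT_interval D f a x (Rmax (f x) (- 1)) HD Hf Da Dx)
      as [z [Dz Hz]].
    + rewrite Hfa, (Rmin_right 0), (Rmax_left 0) by lra; split; [apply Rmax_l|].
      apply Rmax_lub; lra.
    + specialize (Hsin z Dz); rewrite Hz in Hsin.
      assert (Rmax (f x) (-1) < 0) by (apply Rmax_lub_lt; lra).
      assert (H1 := Rmax_r (f x) (-1)).
      assert (sin (Rmax (f x) (-1)) < 0) by (apply sin_lt_0_var; lra).
      lra.
  - destruct (IVT_interval D f a x (Rmin (f x) 1) HD Hf Da Dx)
      as [z [Dz Hz]].
    + rewrite Hfa, (Rmin_left 0), (Rmax_right 0) by lra; split; [|apply Rmin_l].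
      apply Rmin_glb; lra.
    + specialize (Hsin z Dz); rewrite Hz in Hsin.
      assert (0 < Rmin (f x) 1) by (apply Rmin_glb_lt; lra).
      assert (H1 := Rmin_r (f x) 1).
      assert (0 < sin (Rmin (f x) 1)) by (apply sin_gt_0; lra).
      lra.
Qed.

(* Composing with [clamp] extends [f] and [f'] continuously to the whole line, so
   that the two-sided theory applies although the endpoints of [D] may belong to
   [[a, b]]. *)
Lemma RInt_derive_within (D : R -> Prop) (F f : R -> R) (a b : R) :
  nondegenerate_interval D -> D a -> D b -> continuous_on D f ->
  (forall x, D x -> is_derive_within D F x (f x)) ->
  RInt f a b = F b - F a.
Proof.
  intros HD Da Db Hf HF.
  pose (c := clamp (Rmin a b) (Rmax a b)).
  assert (Hc := Rmin_le_Rmax a b).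
  assert (HDab := interval_between D a b HD Da Db).
  assert (Hfc : forall x, continuous (fun y => f (c y)) x)
    by (apply (continuous_clamp D); assumption).
  assert (HFc : forall x, continuous (fun y => F (c y)) x).
  { apply (continuous_clamp D); auto.
    intros x Dx; exact (is_derive_within_continuous D F x (f x) Dx (HF x Dx)). }
  (* The clamped integrand is continuous everywhere, so its primitive [G] has a two-sided derivative
     everywhere, endpoints included. *)
  pose (G := fun x => RInt (fun y => f (c y)) a x).
  assert (HG : forall x, is_derive G x (f (c x))).
  { intros x; apply (is_derive_RInt (fun y => f (c y)) G a x); [|apply Hfc].
    apply filter_forall; intros y.
    apply (RInt_correct (V := R_CompleteNormedModule)), ex_RInt_continuous; auto. }
  (* The difference has zero derivative strictly between [a] and [b], where a neighbourhood lies in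
     [D]; at the endpoints continuity is enough. Hence its values at [a] and [b] agree. *)
  destruct (MVT_gen (fun x => F (c x) - G x) a b (fun _ => 0)) as [z [_ Hz]].
  - intros x Hx.
    assert (Hloc : locally x (fun y => Rmin a b < y < Rmax a b))
      by (apply (open_and _ _ (open_gt _) (open_lt _)); exact Hx).
    assert (HFx : is_derive (fun y => F (c y)) x (f x)).
    { apply is_derive_ext_loc with F.
      - revert Hloc; apply filter_imp; intros y Hy.
        unfold c; rewrite clamp_id; [reflexivity|lra].
      - apply is_derive_within_is_derive with D; [|apply HF, HDab; lra].
        revert Hloc; apply filter_imp; intros y Hy; apply HDab; lra. }
    replace 0 with (minus (f x) (f (c x)))
      by (unfold c; rewrite clamp_id by lra; apply (minus_eq_zero (f x))).
    exact (is_derive_minus _ _ _ _ _ HFx (HG x)).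
  - intros x _; apply continuity_pt_filterlim.
    apply (continuous_minus (fun y => F (c y)) G); [apply HFc|].
    apply ex_derive_continuous; exists (f (c x)); apply HG.
  - replace (RInt f a b) with (G b).
    + assert (HGa : G a = 0) by exact (RInt_point a (fun y => f (c y))).
      unfold c in Hz; rewrite !clamp_id in Hz
        by (apply Rmin_max_l || apply Rmin_max_r).
      lra.
    + apply RInt_ext; intros x Hx; unfold c; rewrite clamp_id; [reflexivity|lra].
Qed.

(** * The rolling wheel *)

(** By the addition formulas, clockwise rotation by [phi] replaces the wheel's angle [theta] by
    [theta - phi]. *)
Lemma position_wheel (r tau : R -> R) (theta phi : R) :
  position tau (wheel r theta) phi =
  (r theta * sin (theta - phi) + tau phi, - r theta * cos (theta - phi)).
Proof.
  unfold position, rotate, wheel; simpl.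
  rewrite sin_minus, cos_minus; f_equal; ring.
Qed.

(** The vertical coordinate is free of [tau]; its derivative [- r theta * sin (theta - phi)] must be
    0 by uniqueness, and [r theta > 0]. *)
Lemma no_slip_sin_eq_0 (J : R -> Prop) (r tau : R -> R) (theta phi : R) :
  nondegenerate_interval J -> J phi -> 0 < r theta ->
  is_derive_within J (position tau (wheel r theta)) phi (0, 0) ->
  sin (theta - phi) = 0.
Proof.
  intros HJ Jphi Hr H.
  apply is_derive_within_snd in H.
  apply filterdiff_ext with (g := fun x => - r theta * cos (theta - x)) in H;
    [|intros x; rewrite position_wheel; reflexivity].
  assert (Hd : is_derive_within J (fun x => - r theta * cos (theta - x)) phi
                 (- r theta * sin (theta - phi))).
  { apply is_derive_is_derive_within; [exact Jphi|].
    auto_derive; [exact I|unfold Rminus; ring]. }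
  assert (E := is_derive_within_unique _ _ _ _ _ HJ Jphi H Hd); simpl in E.
  symmetry in E; apply Rmult_integral in E; lra.
Qed.

(** [tau] is the horizontal coordinate, of derivative 0, minus the explicit term
    [r theta * sin (theta - x)]. *)
Lemma no_slip_derive_tau (J : R -> Prop) (r tau : R -> R) (theta phi : R) :
  J phi ->
  is_derive_within J (position tau (wheel r theta)) phi (0, 0) ->
  is_derive_within J tau phi (r theta * cos (theta - phi)).
Proof.
  intros Jphi H.
  apply is_derive_within_fst in H.
  assert (Hd : is_derive_within J (fun x => r theta * sin (theta - x)) phi
                 (- (r theta * cos (theta - phi)))).
  { apply is_derive_is_derive_within; [exact Jphi|].
    auto_derive; [exact I|unfold Rminus; ring]. }
  assert (Hm := is_derive_within_minus _ _ _ _ _ _ H Hd).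
  replace (r theta * cos (theta - phi))
    with (minus (fst (0, 0)) (- (r theta * cos (theta - phi))))
    by (unfold minus, plus, opp; simpl; ring).
  revert Hm; apply filterdiff_ext.
  intros x; rewrite position_wheel; unfold minus, plus, opp; simpl; ring.
Qed.

Lemma rolls_smoothly_rho (I : R -> Prop) (r : R -> R) (J : R -> Prop)
  (rho tau : R -> R) :
  nondegenerate_interval I -> I 0 -> (forall theta, I theta -> 0 < r theta) ->
  rolls_smoothly I r J rho tau ->
  forall theta, I theta -> rho theta = theta.
Proof.
  intros HI I0 Hr [HJ HrhoJ Hrho Hrho0 _ _ Hslip] theta Itheta.
  cut (theta - rho theta = 0); [lra|].
  revert theta Itheta.
  (* The base point is 0, where [rho 0 = 0] selects the zero multiple of [PI]. *)
  apply continuous_on_sin_eq_0 with 0; auto.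
  - intros x Ix.
    apply (filterlim_comp_2 (G := locally x) (H := locally (opp (rho x)))
             (fun y => y) (fun y => opp (rho y)) plus).
    + intros P; unfold filtermap, within; apply filter_imp; auto.
    + apply filterlim_comp with (locally (rho x)); [exact (Hrho x Ix)|].
      apply (filterlim_opp (V := R_NormedModule)).
    + apply (filterlim_plus (V := R_NormedModule) x (opp (rho x))).
  - lra.
  - intros x Ix.
    apply (no_slip_sin_eq_0 J r tau); auto.
Qed.

Theorem mainTheorem1 (I : R -> Prop) (r : R -> R) (J : R -> Prop) (rho tau : R -> R)
  (I_interval : nondegenerate_interval I) (I_0 : I 0)
  (r_pos : forall theta, I theta -> 0 < r theta)
  (r_continuous : continuous_on I r)
  (rolls : rolls_smoothly I r J rho tau) :
  forall theta, I theta ->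
    contact_point r rho tau theta = (RInt r 0 theta, - r theta).
Proof.
  assert (Hrho := rolls_smoothly_rho I r J rho tau I_interval I_0 r_pos rolls).
  destruct rolls as [_ HrhoJ _ _ _ Htau0 Hslip].
  assert (HIJ : forall x, I x -> J x)
    by (intros x Ix; rewrite <- (Hrho x Ix); auto).
  assert (Htau : forall x, I x -> is_derive_within I tau x (r x)).
  (* No-slip speaks of derivatives relative to [J], whereas [r] is continuous on [I]; restricting to
     [I] puts both on the interval of integration. *)
  { intros x Ix; apply is_derive_within_subset with J; auto.
    assert (H := Hslip x Ix); rewrite (Hrho x Ix) in H.
    apply no_slip_derive_tau in H; auto.
    rewrite Rminus_diag, cos_0, Rmult_1_r in H; exact H. }
  intros theta Itheta.
  unfold contact_point; rewrite (Hrho theta Itheta), position_wheel.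
  rewrite (RInt_derive_within I tau r 0 theta); auto.
  (* With [rho theta = theta] the sine term drops out, leaving [tau theta], which is the integral
     because [tau 0 = 0]. *)
  rewrite Htau0, Rminus_diag, sin_0, cos_0; apply injective_projections; simpl; ring.
Qed.
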